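(* Let $p\ge 1$, let $\alpha_0\in(0,2]$ be fixed, and let $w:\mathbb{R}^p\to[0,\infty)$ be a measurable weight function with $w(\boldsymbol t)>0$ for all $\boldsymbol t$ outside a set of Lebesgue measure zero, $w(\boldsymbol t)=w(-\boldsymbol t)$, and $\int_{\mathbb{R}^p} w(\boldsymbol t)\,d\boldsymbol t<\infty$. Let $\boldsymbol X$ be a random vector in $\mathbb{R}^p$ with characteristic function $\varphi(\boldsymbol t)=\mathbb{E}(e^{i\boldsymbol t^\top \boldsymbol X})$, and let $\boldsymbol X_1,\boldsymbol X_2,\ldots$ be i.i.d. copies of $\boldsymbol X$. For each $n$ let $\widehat{\boldsymbol\delta}_n\in\mathbb{R}^p$ and $\widehat{\mathbf Q}_n\in\mathcal{M}^p$ be estimators computed from $\boldsymbol X_1,\ldots,\boldsymbol X_n$, and let $T_{n,w}$ be the test statistic built from them, as defined in the context. Suppose that, under the given law of $\boldsymbol X$, there is a (non-random) pair $(\boldsymbol\delta_{\boldsymbol X},\mathbf Q_{\boldsymbol X})\in\mathbb{R}^p\times\mathcal{M}^p$ such that $(\widehat{\boldsymbol\delta}_n,\widehat{\mathbf Q}_n)\to(\boldsymbol\delta_{\boldsymbol X},\mathbf Q_{\boldsymbol X})$ almost surely as $n\to\infty$. Then $$\frac{T_{n,w}}{n}\;\longrightarrow\;\int_{\mathbb{R}^p}\left|\varphi\!\left(\mathbf Q_{\boldsymbol X}^{-1/2}\boldsymbol t\right)-e^{i\boldsymbol t^\top \mathbf Q_{\boldsymbol X}^{-1/2}\boldsymbol\delta_{\boldsymbol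 X}}\,\phi_{\alpha_0}(\boldsymbol t)\right|^2 w(\boldsymbol t)\,d\boldsymbol t$$ almost surely as $n\to\infty$.
   Context: $\mathcal{M}^p$ denotes the set of all symmetric positive definite $p\times p$ matrices. For $\mathbf Q\in\mathcal{M}^p$, $\mathbf Q^{1/2}$ is its symmetric positive definite square root and $\mathbf Q^{-1/2}$ is the inverse of $\mathbf Q^{1/2}$. For $\alpha\in(0,2]$, $\phi_\alpha(\boldsymbol t)=\exp(-\|\boldsymbol t\|^\alpha)$, $\boldsymbol t\in\mathbb{R}^p$ (Euclidean norm), is the characteristic function of the spherical stable-Paretian law with characteristic exponent $\alpha$ (location $\boldsymbol 0$, dispersion matrix the identity). Given estimators $(\widehat{\boldsymbol\delta}_n,\widehat{\mathbf Q}_n)$ computed from $\boldsymbol X_1,\ldots,\boldsymbol X_n$, the standardized data are $$\boldsymbol Y_j=\widehat{\mathbf Q}_n^{-1/2}(\boldsymbol X_j-\widehat{\boldsymbol\delta}_n),\qquad j=1,\ldots,n,$$ their empirical characteristic function is $$\phi_n(\boldsymbol t)=\frac1n\sum_{j=1}^n e^{i\boldsymbol t^\top\boldsymbol Y_j},$$ and the test statistic is $$T_{n,w}=n\int_{\mathbb{R}^p}\left|\phi_n(\boldsymbol t)-\phi_{\alpha_0}(\boldsymbol t)\right|^2 w(\boldsymbol t)\,d\boldsymbol t.$$ The law of $\boldsymbol X$ is arbitrary: it is not assumed to be stable. *)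

(* Defs.v *)
From HB Require Import structures.
From mathcomp Require Import all_boot all_order all_algebra.
From mathcomp Require Import all_classical all_reals all_analysis.
From mathcomp Require Import finmap complex.

Set Implicit Arguments.
Unset Strict Implicit.
Unset Printing Implicit Defensive.

Import Order.TTheory GRing.Theory Num.Theory.
Import numFieldNormedType.Exports.

Local Open Scope classical_set_scope.
Local Open Scope ring_scope.

(* Matrices carry the product sigma-algebra, generated by the coordinate maps;
   over a realType it is the Borel sigma-algebra. *)
Definition measure_matrix_display : measure_display -> measure_display.
Proof. exact. Qed.

Section measurable_matrix.
Context {d} {T : measurableType d} (m n : nat).

Definition mx_cylinder : set (set 'M[T]_(m, n)) :=
  [set A | exists i j (B : set T),
    measurable B /\ A = [set M : 'M[T]_(m, n) | B (M i j)]].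

Let mx_set0 : <<s mx_cylinder >> set0.
Proof. exact: sigma_algebra0. Qed.

Let mx_setC A : <<s mx_cylinder >> A -> <<s mx_cylinder >> (~` A).
Proof. exact: sigma_algebraC. Qed.

Let mx_bigcup (F : (set 'M[T]_(m, n))^nat) :
  (forall i, <<s mx_cylinder >> (F i)) ->
  <<s mx_cylinder >> (\bigcup_i (F i)).
Proof. exact: sigma_algebra_bigcup. Qed.

HB.instance Definition _ := @isMeasurable.Build (measure_matrix_display d)
  'M[T]_(m, n) <<s mx_cylinder >> mx_set0 mx_setC mx_bigcup.

Lemma measurable_mx_entry (i : 'I_m) (j : 'I_n) :
  measurable_fun [set: 'M[T]_(m, n)] (fun M : 'M[T]_(m, n) => M i j).
Proof.
move=> _ B mB; rewrite setTI; apply: sub_sigma_algebra.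
by exists i, j, B.
Qed.

Lemma measurable_fun_mxP d' (U : measurableType d') (f : U -> 'M[T]_(m, n)) :
  measurable_fun [set: U] f <->
  forall i j, measurable_fun [set: U] (fun u => f u i j).
Proof.
split=> [mf i j|mf].
  exact: (measurableT_comp (measurable_mx_entry i j) mf).
apply: (@measurability _ _ _ _ [set: U] f mx_cylinder) => //.
move=> _ [_ [i [j [B [mB ->]]]] <-].
exact: (mf i j).
Qed.

End measurable_matrix.

Section cons_col.
Context {R : realType} (n : nat).

Definition cons_col (x : R * 'cV[R]_n) : 'cV[R]_n.+1 :=
  col_mx (const_mx x.1 : 'cV_1) x.2.

Definition uncons_col (v : 'cV[R]_n.+1) : R * 'cV[R]_n :=
  (v ord0 ord0, \col_i v (lift ord0 i) ord0).

Lemma cons_col0 x j : cons_col x ord0 j = x.1.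
Proof.
have -> : ord0 = lshift n (ord0 : 'I_1) by apply: ord_inj.
by apply: (etrans (col_mxEu _ _ _ _)); rewrite mxE.
Qed.

Lemma cons_colS x i j : cons_col x (lift ord0 i) j = x.2 i j.
Proof.
have -> : lift ord0 i = rshift 1 i by apply: ord_inj.
exact: col_mxEd.
Qed.

Lemma cons_colK : cancel cons_col uncons_col.
Proof.
move=> [a v]; rewrite /uncons_col cons_col0; congr pair.
by apply/colP => i; rewrite mxE cons_colS.
Qed.

Lemma measurable_cons_col : measurable_fun [set: R * 'cV[R]_n] cons_col.
Proof.
apply/measurable_fun_mxP => i j; have [k ->|->] := unliftP ord0 i.
  under eq_fun do rewrite cons_colS.
  exact: (measurableT_comp (measurable_mx_entry k j) measurable_snd).
by under eq_fun do rewrite cons_col0; exact: measurable_fst.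
Qed.

Lemma measurable_uncons_col : measurable_fun [set: 'cV[R]_n.+1] uncons_col.
Proof.
apply/measurable_fun_pairP; split; first exact: measurable_mx_entry.
apply/measurable_fun_mxP => i j /=.
under eq_fun do rewrite mxE.
exact: measurable_mx_entry.
Qed.

End cons_col.

Section lebesgue_col.
Context {R : realType}.

Section cons_measure.
Variables (n : nat) (mu : {sigma_finite_measure set 'cV[R]_n -> \bar R}).

Definition lebesgue_cons : set 'cV[R]_n.+1 -> \bar R :=
  pushforward (lebesgue_measure \x mu)%E (@cons_col R n).

Let lebesgue_cons0 : lebesgue_cons set0 = 0%E.
Proof. by rewrite /lebesgue_cons /pushforward preimage_set0 measure0. Qed.

Let lebesgue_cons_ge0 A : (0 <= lebesgue_cons A)%E.
Proof. by rewrite /lebesgue_cons /pushforward measure_ge0. Qed.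

Let lebesgue_cons_sigma_additive : semi_sigma_additive lebesgue_cons.
Proof.
by apply: measure_semi_sigma_additive; exact: measurable_cons_col.
Qed.

HB.instance Definition _ := isMeasure.Build _ _ _ lebesgue_cons
  lebesgue_cons0 lebesgue_cons_ge0 lebesgue_cons_sigma_additive.

Let lebesgue_cons_sigma_finite : sigma_finite setT lebesgue_cons.
Proof.
have /sigma_finiteP[F [TF ndF Foo]] := sigma_finiteT (@lebesgue_measure R).
have /sigma_finiteP[G [TG ndG Goo]] := sigma_finiteT mu.
exists (fun k => @uncons_col R n @^-1` (F k `*` G k)).
  apply/esym; rewrite -subTset => v _.
  have [k _ Fk] : (\bigcup_k F k) (uncons_col v).1 by rewrite -TF.
  have [l _ Gl] : (\bigcup_k G k) (uncons_col v).2 by rewrite -TG.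
  exists (maxn k l) => //; split.
    by move: Fk; exact/subsetPset/ndF/leq_maxl.
  by move: Gl; exact/subsetPset/ndG/leq_maxr.
move=> k; have [mF Fk] := Foo k; have [mG Gk] := Goo k; split.
  rewrite -[X in measurable X]setTI.
  by apply: measurable_uncons_col => //; exact: measurableX.
rewrite /lebesgue_cons /pushforward -comp_preimage.
rewrite (_ : _ \o _ = id); last by apply/funext => x /=; rewrite cons_colK.
by rewrite preimage_id product_measure1E// lte_mul_pinfty// ge0_fin_numE.
Qed.

HB.instance Definition _ := Measure_isSigmaFinite.Build _ _ _ lebesgue_cons
  lebesgue_cons_sigma_finite.

End cons_measure.

(* Lebesgue measure on R^n, as the n-fold product of lebesgue_measure. *)
Fixpoint lebesgue_col (n : nat) : {sigma_finite_measure set 'cV[R]_n -> \bar R} :=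
  match n with
  | 0 => [the {sigma_finite_measure set 'cV[R]_0 -> \bar R} of \d_(0 : 'cV[R]_0)]
  | n'.+1 => [the {sigma_finite_measure set 'cV[R]_n'.+1 -> \bar R} of
               lebesgue_cons (lebesgue_col n')]
  end.

Lemma measurable_box n (a b : 'cV[R]_n) :
  measurable [set v : 'cV[R]_n | forall i, a i 0 <= v i 0 <= b i 0].
Proof.
rewrite (_ : [set v | _] =
    \bigcap_(i in [set: 'I_n]) [set v : 'cV[R]_n | v i 0 \in `[a i 0, b i 0]]).
  apply: fin_bigcap_measurable => [|i _]; first exact: finite_finset.
  rewrite -[X in measurable X]setTI.
  exact: (measurable_mx_entry i 0 measurableT (measurable_itv `[a i 0, b i 0])).
apply/seteqP; split => [v vab i _|v vab i]; first by rewrite /= in_itv; exact: vab.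
by have := vab i I; rewrite /= in_itv.
Qed.

Lemma lebesgue_col_box n (a b : 'cV[R]_n) : (forall i, a i 0 <= b i 0) ->
  lebesgue_col n [set v : 'cV[R]_n | forall i, a i 0 <= v i 0 <= b i 0] =
  (\prod_(i < n) (b i 0 - a i 0))%:E.
Proof.
elim: n a b => [|n IH] a b ab.
  rewrite big_ord0 /= diracE mem_set//=.
  by case.
pose tl (v : 'cV[R]_n.+1) : 'cV[R]_n := \col_i v (lift ord0 i) 0.
transitivity ((lebesgue_measure \x lebesgue_col n)%E (`[a ord0 0, b ord0 0] `*`
    [set v : 'cV[R]_n | forall i, tl a i 0 <= v i 0 <= tl b i 0])).
  rewrite /= /lebesgue_cons /pushforward; congr (product_measure1 _ _ _).
  apply/seteqP; split => [[x v] /= h|[x v] /= [hx hv] i].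
    split; first by have := h ord0; rewrite cons_col0 in_itv.
    by move=> i; have := h (lift ord0 i); rewrite cons_colS !mxE.
  have [k ->|->] := unliftP ord0 i; last first.
    by rewrite cons_col0; move: hx; rewrite in_itv.
  by have := hv k; rewrite cons_colS !mxE.
rewrite product_measure1E//=; last first.
  exact: measurable_box.
rewrite IH; last by move=> i; rewrite !mxE.
rewrite big_ord_recl lebesgue_measure_itv/= lte_fin EFinM; congr (_ * _)%E.
  have := ab ord0; rewrite le_eqVlt => /orP[/eqP ->|->]; last by rewrite EFinB.
  by rewrite ltxx subrr.
by congr EFin; apply: eq_bigr => i _; rewrite !mxE.
Qed.

End lebesgue_col.

Section matrices.
Context {R : realType} {p : nat}.
Implicit Types (Q : 'M[R]_p) (t x : 'cV[R]_p).

Definition dotp t x : R := (t^T *m x) 0 0.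

(* The library norm on matrices is the sup norm. *)
Definition enorm t : R := Num.sqrt (dotp t t).

Definition posdefmx Q : Prop :=
  Q^T = Q /\ forall t, t != 0 -> 0 < dotp t (Q *m t).

(* For posdefmx Q the set below is a singleton. *)
Definition sqrtmx Q : 'M[R]_p := xget 0 [set S | posdefmx S /\ S *m S = Q].

Definition invsqrtmx Q : 'M[R]_p := invmx (sqrtmx Q).

End matrices.

Section characteristic_functions.
Context {R : realType} {p : nat}.

Definition expi (x : R) : R[i] := (cos x +i* sin x)%C.

Definition charfun d (T : measurableType d) (P : probability T R)
    (X : {RV P >-> 'cV[R]_p}) (t : 'cV[R]_p) : R[i] :=
  (fine 'E_P[fun x => cos (dotp t (X x))] +i*
   fine 'E_P[fun x => sin (dotp t (X x))])%C.

Definition phi_stable (alpha : R) (t : 'cV[R]_p) : R :=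
  expR (- (enorm t `^ alpha)).

Definition standardize (delta : 'cV[R]_p) (Q : 'M[R]_p) n
    (x : n.-tuple 'cV[R]_p) : n.-tuple 'cV[R]_p :=
  [tuple invsqrtmx Q *m (tnth x j - delta) | j < n].

Definition ecf n (y : n.-tuple 'cV[R]_p) (t : 'cV[R]_p) : R[i] :=
  n%:R^-1 * \sum_(j < n) expi (dotp t (tnth y j)).

Definition test_statistic (alpha : R) (w : 'cV[R]_p -> R) (delta : 'cV[R]_p)
    (Q : 'M[R]_p) n (x : n.-tuple 'cV[R]_p) : R :=
  n%:R * \int[lebesgue_col p]_t
    (Normc.normc (ecf (standardize delta Q x) t - (phi_stable alpha t)%:C%C) ^+ 2
     * w t).

End characteristic_functions.

Section iid.
Context {R : realType} d d' (T : measurableType d) (V : measurableType d').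
Variable P : probability T R.

Definition mutually_independent (X : nat -> {RV P >-> V}) : Prop :=
  forall (J : {fset nat}) (A : nat -> set V),
    (forall j, j \in J -> measurable (A j)) ->
    P (\bigcap_(j in [set` J]) X j @^-1` A j) =
    (\prod_(j <- J) P (X j @^-1` A j))%E.

(* distribution P X is only compared on measurable sets, where it is the law
   of X. *)
Definition identically_distributed (X Y : {RV P >-> V}) : Prop :=
  forall A : set V, measurable A -> distribution P X A = distribution P Y A.

Definition sample (X : nat -> {RV P >-> V}) (n : nat) (x : T) : n.-tuple V :=
  [tuple X j x | j < n].

End iid.

(* Main.v *)
(* Multiplying phi_n(t) by exp(i t.Q_n^(-1/2) delta_n) turns it into the empirical
   characteristic function psi_n of the raw sample at the random point
   s_n = Q_n^(-1/2) t, so T_n / n is the w-integral of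
   |psi_n(s_n) - exp(i s_n.delta_n) phi_alpha(t)|^2. Since Q -> Q^(-1/2) is
   continuous at positive definite matrices, s_n -> Q_X^(-1/2) t almost surely,
   for all t at once. The strong law for bounded functions, applied at the
   countably many rational points and to the moduli min(2, |x|_1 / (k + 1)),
   gives almost surely psi_n(s_n) -> phi(s) along every sequence s_n -> s. The
   integrand is at most 8 w, and dominated convergence concludes. *)
Require Import Defs.
From HB Require Import structures.
From mathcomp Require Import all_boot all_order all_algebra.
From mathcomp Require Import all_classical all_reals all_analysis measurable_realfun.
From mathcomp Require Import complex finmap spectral.
From mathcomp Require Import ring lra zify.

Set Implicit Arguments.
Unset Strict Implicit.
Unset Printing Implicit Defensive.

Import Order.TTheory GRing.Theory Num.Theory.
Import numFieldNormedType.Exports.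

Local Open Scope classical_set_scope.
Local Open Scope ring_scope.

(** * Square roots of positive definite matrices *)

Section posdef.
Context {R : realType} {p : nat}.
Implicit Types (S Q D : 'M[R]_p) (t x y : 'cV[R]_p).

Lemma dotpE t x : dotp t x = \sum_i t i 0 * x i 0.
Proof. by rewrite /dotp mxE; apply: eq_bigr => i _; rewrite mxE. Qed.

Lemma dotpC t x : dotp t x = dotp x t.
Proof. by rewrite !dotpE; apply: eq_bigr => i _; rewrite mulrC. Qed.

Lemma dotp_mulmx Q t x : dotp t (Q *m x) = dotp (Q^T *m t) x.
Proof. by rewrite /dotp trmx_mul trmxK mulmxA. Qed.

Lemma dotpBr t x y : dotp t (x - y) = dotp t x - dotp t y.
Proof. by rewrite /dotp mulmxBr !mxE. Qed.

Lemma dotpBl t x y : dotp (t - x) y = dotp t y - dotp x y.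
Proof. by rewrite ![dotp _ y]dotpC dotpBr. Qed.

Lemma dotpZr (a : R) t x : dotp t (a *: x) = a * dotp t x.
Proof. by rewrite /dotp -scalemxAr mxE. Qed.

Lemma dotpZl (a : R) t x : dotp (a *: t) x = a * dotp t x.
Proof. by rewrite dotpC dotpZr dotpC. Qed.

Lemma dotpp_ge0 t : 0 <= dotp t t.
Proof. by rewrite dotpE sumr_ge0// => i _; rewrite -expr2 sqr_ge0. Qed.

Lemma posdefmx_form_ge0 Q t : posdefmx Q -> 0 <= dotp t (Q *m t).
Proof.
move=> [_ Qp]; have [->|/Qp/ltW//] := eqVneq t 0.
by rewrite /dotp mulmx0 mulmx0 mxE.
Qed.

(** The [i]-th diagonal entry of the product is the form of [S] at column [i] of [D], so positivity
    on vectors passes to traces. *)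
Lemma mxtrace_sandwich D S :
  \tr (D^T *m S *m D) = \sum_i dotp (col i D) (S *m col i D).
Proof.
apply: eq_bigr => i _; rewrite /dotp tr_col [col i D]colE (mulmxA S) -colE -mulmxA.
by move: (S *m D) => B; rewrite !mxE; apply: eq_bigr => k _; rewrite !mxE.
Qed.

Lemma posdefmx_mxtrace_ge0 D S : posdefmx S -> 0 <= \tr (D^T *m S *m D).
Proof.
by move=> Sp; rewrite mxtrace_sandwich sumr_ge0// => i _; exact: posdefmx_form_ge0.
Qed.

Lemma posdefmx_mxtrace_eq0 D S :
  posdefmx S -> \tr (D^T *m S *m D) = 0 -> D = 0.
Proof.
move=> Sp; rewrite mxtrace_sandwich => /eqP.
rewrite psumr_eq0 => [/allP h|i _]; last exact: posdefmx_form_ge0.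
apply/matrixP => i j; have [] := eqVneq (col j D) 0 => [/colP/(_ i)|].
  by rewrite !mxE.
by move/(proj2 Sp); have /eqP -> := h j (mem_index_enum _); rewrite ltxx.
Qed.

(** Multiplying the equation by [D^T] and taking traces gives, by cyclicity, the sandwich traces of
    [D] and [D^T]: both are nonnegative and their sum is zero. *)
Lemma posdefmx_sylvester_eq0 S D :
  posdefmx S -> S *m D + D *m S = 0 -> D = 0.
Proof.
move=> Sp SD; apply: (posdefmx_mxtrace_eq0 Sp); apply/eqP.
have : \tr (D^T *m S *m D) + \tr (D^T^T *m S *m D^T) = 0.
  rewrite trmxK [X in _ + X]mxtrace_mulC -mxtraceD -mulmxA -mulmxDr.
  by rewrite SD mulmx0 mxtrace0.
have := posdefmx_mxtrace_ge0 D Sp; have := posdefmx_mxtrace_ge0 D^T Sp.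
by move=> h1 h2 /eqP; rewrite paddr_eq0// => /andP[].
Qed.


(** By cyclicity the left side is the trace of [D *m (S *m D + D *m S')], whose inner sum
    telescopes. This controls a difference of square roots by the difference of the squares. *)
Lemma mxtrace_subsqr S S' (D := S - S') : S^T = S -> S'^T = S' ->
  \tr (D^T *m S *m D) + \tr (D^T *m S' *m D) =
  \tr (D *m (S *m S - S' *m S')).
Proof.
move=> ST ST'; have DT : D^T = D by rewrite /D linearB/= ST ST'.
rewrite DT [X in _ + X]mxtrace_mulC -mxtraceD -mulmxA -mulmxDr.
by congr (\tr (_ *m _)); rewrite /D mulmxBl mulmxBr addrA subrK.
Qed.

Lemma posdefmx_unit S : posdefmx S -> S \in unitmx.
Proof.
move=> Sp; rewrite -unitmx_tr -row_free_unit -kermx_eq0.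
apply/rowV0P => v /sub_kermxP vS; apply/eqP/negPn/negP => v0.
have := proj2 Sp v^T; rewrite trmx_eq0 => /(_ v0).
have -> : S *m v^T = 0 by rewrite -[S]trmxK -trmx_mul vS trmx0.
by rewrite /dotp mulmx0 mxE ltxx.
Qed.

End posdef.

(** * Existence of the positive definite square root, by the spectral theorem *)

Section posdef_sqrt.
Context {R : realType} {p : nat}.
Local Notation toC := (map_mx (real_complex R)).
Local Notation C := R[i].
Local Open Scope sesquilinear_scope.

Lemma conjC_complexE (z : C) : Num.conj z = ((complex.Re z) -i* (complex.Im z))%C.
Proof. by case: z. Qed.

Lemma Re_mulr_conj (z w : C) (q : R) :
  complex.Re (z * (q%:C)%C * Num.conj w) =
  complex.Re z * q * complex.Re w + complex.Im z * q * complex.Im w.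
Proof. by case: z w => [a b] [u v]; rewrite conjC_complexE/=; ring. Qed.

(** A real symmetric matrix is Hermitian over [R[i]], hence unitarily diagonalizable with real
    eigenvalues. The [k]-th eigenvalue is the sum of the forms of [Q] at the real and imaginary
    parts of row [k] of [P], hence positive. *)
Lemma posdefmx_spectral (Q : 'M[R]_p) : posdefmx Q ->
  exists (P : 'M[C]_p) (r : 'rV[R]_p), [/\ P *m P^t* = 1%:M,
    forall k, 0 < r 0 k & toC Q = P^t* *m diag_mx (toC r) *m P].
Proof.
move=> Qp; have QT : (toC Q)^t* = toC Q.
  apply/matrixP => i j; rewrite !mxE conjC_complexE/= oppr0.
  by rewrite -[in LHS](proj1 Qp) mxE.
have /orthomx_spectralP QE : toC Q \is normalmx.
  by apply/normalmxP; rewrite QT.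
set P := spectralmx _ in QE; set s := spectral_diag _ in QE.
have PU : P \is unitarymx by exact: spectral_unitarymx.
have PP : P *m P^t* = 1%:M by apply/unitarymxP.
rewrite invmx_unitary// in QE.
have sE : diag_mx s = P *m toC Q *m P^t*.
  by rewrite QE !mulmxA PP mul1mx -mulmxA PP mulmx1.
have skE k : s 0 k = \sum_i \sum_j P k i * toC Q i j * Num.conj (P k j).
  have := congr1 (fun M : 'M[C]_p => M k k) sE; rewrite !mxE eqxx mulr1n => ->.
  rewrite exchange_big; apply: eq_bigr => j _; rewrite mxE mulr_suml.
  by apply: eq_bigr => i _; rewrite !mxE.
exists P, (map_mx (@complex.Re R) s); split=> // [k|].
  pose a : 'cV[R]_p := \col_i complex.Re (P k i).
  pose b : 'cV[R]_p := \col_i complex.Im (P k i).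
  have -> : map_mx (@complex.Re R) s 0 k = dotp a (Q *m a) + dotp b (Q *m b).
    rewrite mxE skE !dotpE -big_split raddf_sum/=; apply: eq_bigr => i _.
    rewrite raddf_sum !mxE !mulr_sumr -big_split/=; apply: eq_bigr => j _.
    by rewrite !mxE Re_mulr_conj !mulrA.
  (* Row [k] of the unitary [P] has norm 1, so [a] and [b] cannot both vanish. *)
  have [a0|a0] := eqVneq a 0; last first.
    by rewrite ltr_pwDl// ?posdefmx_form_ge0// (proj2 Qp).
  have [b0|b0] := eqVneq b 0; last first.
    by rewrite ltr_wpDl// ?posdefmx_form_ge0// (proj2 Qp).
  have Pk i : P k i = 0.
    have /colP/(_ i) := a0; have /colP/(_ i) := b0; rewrite !mxE.
    by case: (P k i) => u v /= -> ->.
  have := congr1 (fun M : 'M[C]_p => M k k) PP; rewrite !mxE eqxx => /eqP.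
  by rewrite big1 ?[0 == _]eq_sym ?oner_eq0// => i _; rewrite Pk mul0r.
rewrite QE; congr (_ *m diag_mx _ *m _); apply/rowP => k; rewrite !mxE.
have : toC Q \is hermsymmx by apply/is_hermitianmxP; rewrite expr0 scale1r QT.
by move=> /hermitian_spectral_diag_real/mxOverP/(_ 0 k)/RRe_real ->.
Qed.

(* The Hermitian square root of Q is U + iV with U, V real; comparing imaginary
   parts of its square gives UV + VU = 0, which forces V = 0. *)
Lemma posdefmx_sqrt_ex (Q : 'M[R]_p) :
  posdefmx Q -> exists S, posdefmx S /\ S *m S = Q.
Proof.
move=> /posdefmx_spectral[P [r [PP r0 QE]]].
have PP' : P^t* *m P = 1%:M by exact: mulmx1C.
pose q : 'rV[R]_p := map_mx Num.sqrt r.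
have q0 k : 0 < q 0 k by rewrite mxE sqrtr_gt0.
have [Sc ScE] : exists Sc, Sc = P^t* *m diag_mx (toC q) *m P by eexists.
have ScSc : Sc *m Sc = toC Q.
  rewrite QE ScE -!mulmxA (mulmxA P) PP mul1mx; congr (_ *m _).
  rewrite mulmxA mulmx_diag; congr (diag_mx _ *m _); apply/rowP => k.
  by rewrite !mxE -rmorphM/= -expr2 sqr_sqrtr// ltW.
have ScT : Sc^t* = Sc.
  rewrite ScE !trmx_mul !map_mxM trmxCK tr_diag_mx map_diag_mx mulmxA.
  congr (_ *m diag_mx _ *m _); apply/rowP => k.
  by rewrite !mxE -[LHS]/(Num.conj _) conjC_complexE/= oppr0.
pose U := map_mx (@complex.Re R) Sc; pose V := map_mx (@complex.Im R) Sc.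
have UV : U *m V + V *m U = 0.
  apply/matrixP => i j; have /matrixP/(_ i j) := ScSc.
  rewrite !mxE => /(congr1 (@complex.Im R)); rewrite raddf_sum/=.
  apply: etrans; rewrite -big_split/=; apply: eq_bigr => k _; rewrite !mxE.
  by case: (Sc i k) (Sc k j) => [a b] [c d] /=; ring.
have UU : U *m U - V *m V = Q.
  apply/matrixP => i j; have /matrixP/(_ i j) := ScSc.
  rewrite !mxE => /(congr1 (@complex.Re R)); rewrite raddf_sum/=.
  apply: etrans; rewrite -sumrB/=; apply: eq_bigr => k _; rewrite !mxE.
  by case: (Sc i k) (Sc k j) => [a b] [c d] /=; ring.
have Up : posdefmx U.
  split=> [|x x0].
    apply/matrixP => i j; rewrite !mxE; have /matrixP/(_ i j) := ScT.
    by rewrite !mxE => <-; rewrite conjC_complexE.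
  (* For real [x] the form of [U] is the real part of that of [Sc], which in the coordinates [y] is
     a sum of squared moduli with the positive weights [q]. *)
  pose xc := toC x; have [y yP] : exists y, y = P *m xc by eexists.
  have yE : xc^T *m Sc *m xc = y^t* *m diag_mx (toC q) *m y.
    have xcT : xc^t* = xc^T.
      by apply/matrixP => i j; rewrite !mxE conjC_complexE/= oppr0.
    by rewrite ScE yP trmx_mul map_mxM xcT !mulmxA.
  have -> : dotp x (U *m x) = complex.Re ((xc^T *m Sc *m xc) 0 0).
    rewrite dotpE -mulmxA mxE raddf_sum; apply: eq_bigr => i _.
    rewrite !mxE !mulr_sumr raddf_sum; apply: eq_bigr => j _.
    by rewrite !mxE; case: (Sc i j) => a b /=; ring.
  have -> : complex.Re ((xc^T *m Sc *m xc) 0 0) =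
      \sum_k q 0 k * (complex.Re (y k 0) ^+ 2 + complex.Im (y k 0) ^+ 2).
    rewrite yE mul_mx_diag mxE raddf_sum; apply: eq_bigr => k _.
    rewrite !mxE -[Num.conj_op _]/(Num.conj _) conjC_complexE.
    by case: (y k 0) => a b /=; ring.
  have ge0 k : 0 <= q 0 k * (complex.Re (y k 0) ^+ 2 + complex.Im (y k 0) ^+ 2).
    by rewrite mulr_ge0 ?addr_ge0 ?sqr_ge0// ltW.
  rewrite lt0r sumr_ge0// andbT; apply: contraNN x0.
  rewrite psumr_eq0// => /allP y0; apply/eqP.
  have {}y0 : y = 0.
    apply/colP => k; have := y0 k (mem_index_enum _).
    rewrite mulf_eq0 gt_eqF//= paddr_eq0 ?sqr_ge0// !sqrf_eq0 mxE.
    by case: (y k 0) => a b /= /andP[/eqP -> /eqP ->].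
  have : xc = 0 by rewrite -[xc]mul1mx -PP' -mulmxA -yP y0 mulmx0.
  by move=> /matrixP xc0; apply/colP => k; have := xc0 k 0; rewrite !mxE => -[].
exists U; split=> //; rewrite -[RHS]UU (posdefmx_sylvester_eq0 Up UV).
by rewrite mulmx0 subr0.
Qed.

(** [xget] returns its default only on an empty set, which [posdefmx_sqrt_ex] excludes. *)
Lemma sqrtmxP (Q : 'M[R]_p) :
  posdefmx Q -> posdefmx (sqrtmx Q) /\ sqrtmx Q *m sqrtmx Q = Q.
Proof.
by move=> /posdefmx_sqrt_ex[S SQ]; rewrite /sqrtmx; case: xgetP => [? -> //|/(_ S)].
Qed.

End posdef_sqrt.

(** * Continuity of the square root at positive definite matrices *)

Section sqrtmx_continuity.
Context {R : realType} {p : nat}.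
Implicit Types (S Q W : 'M[R]_p) (t : 'cV[R]_p).

Lemma sqr_coord_le_dotp t i : t i 0 ^+ 2 <= dotp t t.
Proof.
rewrite dotpE (bigD1 i)//= -expr2 lerDl sumr_ge0// => j _.
by rewrite -expr2 sqr_ge0.
Qed.

Lemma dotp_mulmx_le W t :
  dotp t (W *m t) <= (\sum_i \sum_j `|W i j|) * dotp t t.
Proof.
rewrite [leLHS]dotpE mulr_suml; apply: ler_sum => i _.
rewrite mxE mulr_sumr mulr_suml; apply: ler_sum => j _.
rewrite mulrCA (le_trans (ler_norm _))// normrM ler_wpM2l//.
rewrite ler_norml.
(* Each product of two coordinates is at most half the sum of their squares in absolute value, hence
   at most [dotp t t]. *)
have := sqr_coord_le_dotp t i; have := sqr_coord_le_dotp t j.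
have := sqr_ge0 (t i 0 + t j 0); have := sqr_ge0 (t i 0 - t j 0); nra.
Qed.

(* With W the inverse of S, expand the form of S at t - W t / K. *)
Lemma posdefmx_coercive S : posdefmx S ->
  exists2 c : R, 0 < c & forall t, c * dotp t t <= dotp t (S *m t).
Proof.
move=> Sp; set W := invmx S; set K := 1 + \sum_i \sum_j `|W i j|.
have K0 : 0 < K.
  by rewrite ltr_pwDl// sumr_ge0// => i _; rewrite sumr_ge0.
exists K^-1 => [|t]; first by rewrite invr_gt0.
have SW : S *m W = 1%:M by rewrite mulmxV// posdefmx_unit.
have := posdefmx_form_ge0 (t - K^-1 *: (W *m t)) Sp.
set u := W *m t; have Su : S *m u = t by rewrite mulmxA SW mul1mx.
have uS : dotp u (S *m t) = dotp t t by rewrite dotp_mulmx (proj1 Sp) Su.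
(* The expansion reads 0 <= t.(S t) - (2/K) t.t + K^-2 t.u; since t.u <= K t.t, it follows that t.(S
   t) >= t.t / K. *)
rewrite mulmxBr -scalemxAr Su dotpBr !dotpBl !dotpZr !dotpZl uS => h.
have : K^-1 ^+ 2 * dotp t u <= K^-1 * dotp t t.
  rewrite expr2 -mulrA ler_pM2l ?invr_gt0// mulrC ler_pdivrMr//.
  rewrite mulrC (le_trans (dotp_mulmx_le W t))// ler_wpM2r ?dotpp_ge0//.
  by rewrite lerDr.
move: h; rewrite (dotpC u t); lra.
Qed.

(** Let [D] be the difference of the roots and [c] the coercivity constant of the limit root, fixed
    along the sequence. Then c |D|^2 <= tr (D^T S D) <= tr (D (Q - Q_n)) in the Frobenius norm,
    which gives |D| <= |Q_n - Q| / c. *)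
Lemma sqrtmx_cvg (Q_ : nat -> 'M[R]_p) Q :
  (forall n, (0 < n)%N -> posdefmx (Q_ n)) -> posdefmx Q ->
  (forall i j, Q_ n i j @[n --> \oo] --> Q i j) ->
  forall i j, sqrtmx (Q_ n) i j @[n --> \oo] --> sqrtmx Q i j.
Proof.
move=> Q_p Qp Q_Q i j; have [Sp SQ] := sqrtmxP Qp.
have [c c0 cS] := posdefmx_coercive Sp.
pose e n := \sum_k \sum_l (Q_ n k l - Q k l) ^+ 2.
have e0 : Num.sqrt (c ^- 2 * e n) @[n --> \oo] --> 0.
  rewrite -[X in _ --> X]sqrtr0 -(mulr0 (c ^- 2)).
  apply: continuous_cvg; first exact: sqrt_continuous.
  apply: cvgM; first exact: cvg_cst.
  rewrite (_ : 0 = \sum_(k < p) \sum_(l < p) (0 : R)); last first.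
    by rewrite big1// => k _; rewrite big1.
  apply: cvg_big => [|k _]; first exact: add_continuous.
  apply: cvg_big => [|l _]; first exact: add_continuous.
  have d0 : Q_ n k l - Q k l @[n --> \oo] --> 0 by exact/subr_cvg0.
  by have := cvgM d0 d0; rewrite mulr0 => h; exact: h.
apply/subr_cvg0; apply: norm_cvg0.
suff le_e : \forall n \near \oo, 0 <= `|sqrtmx (Q_ n) i j - sqrtmx Q i j| <=
    Num.sqrt (c ^- 2 * e n) by exact: (squeeze_cvgr le_e (cvg_cst 0) e0).
near=> n; rewrite normr_ge0/=.
have n0 : (0 < n)%N by near: n; exists 1%N.
have [Tp TQ] := sqrtmxP (Q_p n n0).
set T := sqrtmx (Q_ n) in Tp TQ *; set S := sqrtmx Q in Sp SQ cS *.
rewrite -sqrtr_sqr ler_wsqrtr//.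
pose D := S - T.
have DE : \tr (D^T *m S *m D) <= \tr (D *m (Q - Q_ n)).
  rewrite -SQ -TQ -mxtrace_subsqr ?(proj1 Sp) ?(proj1 Tp)//.
  by rewrite lerDl posdefmx_mxtrace_ge0.
have cD : c * (\sum_k \sum_l D k l ^+ 2) <= \tr (D^T *m S *m D).
  rewrite exchange_big mxtrace_sandwich mulr_sumr ler_sum// => k _.
  apply: le_trans (cS _); rewrite dotpE ler_pM2l//; apply: ler_sum => l _.
  by rewrite !mxE -expr2.
(* Young's inequality entry by entry, from (c x + y)^2 / (2 c) >= 0. The weight c / 2 lets half of
   the lower bound [cD] absorb the quadratic term in [D]. *)
have ED : \tr (D *m (Q - Q_ n)) <=
    c / 2 * (\sum_k \sum_l D k l ^+ 2) + (c *+ 2)^-1 * e n.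
  rewrite /e [X in _ + _ * X]exchange_big !mulr_sumr -big_split/=.
  apply: ler_sum => k _; rewrite !mxE !mulr_sumr -big_split/=.
  apply: ler_sum => l _; rewrite !mxE.
  set x := S k l - T k l; set y := Q_ n l k - Q l k.
  have -> : Q l k - Q_ n l k = - y by rewrite opprB.
  have : 0 <= (c * x + y) ^+ 2 / (c *+ 2).
    by rewrite divr_ge0 ?sqr_ge0// mulrn_wge0// ltW.
  have -> : (c * x + y) ^+ 2 / (c *+ 2) =
      c / 2 * x ^+ 2 + x * y + (c *+ 2)^-1 * y ^+ 2.
    by field; rewrite gt_eqF.
  lra.
have ijD : (T i j - S i j) ^+ 2 <= \sum_k \sum_l D k l ^+ 2.
  rewrite (bigD1 i)//= (bigD1 j)//= !mxE -sqrrN opprB -addrA lerDl.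
  rewrite addr_ge0// sumr_ge0// => k _; rewrite ?sqr_ge0//.
  by rewrite sumr_ge0// => l _; rewrite sqr_ge0.
apply: le_trans ijD _; set d := \sum_k _ in cD ED *.
rewrite -(@ler_pM2l _ (c / 2)) ?divr_gt0//.
have -> : c / 2 * (c ^- 2 * e n) = (c *+ 2)^-1 * e n by field; rewrite gt_eqF.
lra.
Unshelve. all: by end_near.
Qed.

End sqrtmx_continuity.

(** * Continuity of the inverse and of the inverse square root *)

Section invmx_continuity.
Context {R : realType}.

(** The Leibniz formula is a finite sum of finite products of entries. *)
Lemma det_cvg p (A_ : nat -> 'M[R]_p) (A : 'M[R]_p) :
  (forall i j, A_ n i j @[n --> \oo] --> A i j) ->
  \det (A_ n) @[n --> \oo] --> \det A.
Proof.
move=> A_A; apply: cvg_big => [|s _]; first exact: add_continuous.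
apply: cvgM; first exact: cvg_cst.
by apply: cvg_big => [|i _]; [exact: mul_continuous|exact: A_A].
Qed.

Lemma invmx_cvg p (A_ : nat -> 'M[R]_p) (A : 'M[R]_p) :
  (forall n, (0 < n)%N -> A_ n \in unitmx) -> A \in unitmx ->
  (forall i j, A_ n i j @[n --> \oo] --> A i j) ->
  forall i j, invmx (A_ n) i j @[n --> \oo] --> invmx A i j.
Proof.
move=> A_u Au A_A i j; rewrite /invmx Au !mxE.
(* [invmx] is given by the adjugate formula only on invertible matrices, so the two sequences are
   compared from n = 1 on. *)
apply: (@cvg_trans _ ((\det (A_ n))^-1 * cofactor (A_ n) j i @[n --> \oo])).
  apply: near_eq_cvg; near=> n.
  have n0 : (0 < n)%N by near: n; exists 1%N.
  by rewrite A_u// !mxE.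
apply: cvgM.
  by apply: cvgV; [rewrite -unitfE -unitmxE|exact: det_cvg].
apply: cvgM; first exact: cvg_cst.
by apply: det_cvg => k l; rewrite !mxE; under eq_fun do rewrite !mxE; exact: A_A.
Unshelve. all: by end_near.
Qed.

Lemma invsqrtmx_cvg p (Q_ : nat -> 'M[R]_p) (Q : 'M[R]_p) :
  (forall n, (0 < n)%N -> posdefmx (Q_ n)) -> posdefmx Q ->
  (forall i j, Q_ n i j @[n --> \oo] --> Q i j) ->
  forall i j, invsqrtmx (Q_ n) i j @[n --> \oo] --> invsqrtmx Q i j.
Proof.
move=> Q_p Qp Q_Q; apply: invmx_cvg => [n n0||]; last exact: sqrtmx_cvg.
  by apply: posdefmx_unit; have [] := sqrtmxP (Q_p n n0).
by apply: posdefmx_unit; have [] := sqrtmxP Qp.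
Qed.

Lemma trmx_invsqrtmx p (Q : 'M[R]_p) :
  posdefmx Q -> (invsqrtmx Q)^T = invsqrtmx Q.
Proof. by move=> /sqrtmxP[[QT _] _]; rewrite /invsqrtmx trmx_inv QT. Qed.

End invmx_continuity.

(** * Strong law of large numbers for bounded functions *)

Section bounded_expectation.
Context {R : realType} d (T : measurableType d) (P : probability T R).
Implicit Types f g : T -> R.

Lemma bounded_integrable f (C : R) : measurable_fun [set: T] f ->
  (forall x, `|f x| <= C) -> P.-integrable [set: T] (EFin \o f).
Proof.
move=> mf fC; apply: measurable_bounded_integrable => //.
  by rewrite [X in (X < _)%E]probability_setT ltry.
exists C; split; first exact: num_real.
by move=> M /ltW CM x _; exact: le_trans (fC x) CM.
Qed.

Lemma Rintegral_bound f (C : R) : measurable_fun [set: T] f ->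
  (forall x, `|f x| <= C) -> `|\int[P]_x f x| <= C.
Proof.
move=> mf fC; have intf := bounded_integrable mf fC.
apply: (le_trans (le_normr_Rintegral measurableT intf)).
apply: (@le_trans _ _ (\int[P]_x cst C x)).
  apply: le_Rintegral => //; first exact: integrable_norm.
  by apply: (@bounded_integrable _ `|C|) => //.
by rewrite Rintegral_cst// [X in fine X]probability_setT mulr1.
Qed.

End bounded_expectation.

(** * Summability and subsequence tools for almost sure convergence *)

Section almost_sure_convergence.
Context {R : realType} d (T : measurableType d) (P : probability T R).

(** By monotone convergence the series of the [f k] has a finite integral, hence is almost surely
    finite, and each term is bounded by a tail that tends to zero. *)
Lemma ae_cvg0_summable (f : nat -> T -> R) (M : R) :
  (forall k, measurable_fun [set: T] (f k)) -> (forall k x, 0 <= f k x) ->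
  (forall n, (\sum_(0 <= k < n) \int[P]_x (f k x)%:E <= M%:E)%E) ->
  {ae P, forall x, f k x @[k --> \oo] --> 0}.
Proof.
move=> mf f0 sumM.
have mfE k : measurable_fun [set: T] (EFin \o f k) by exact/measurable_EFinP.
pose s (x : T) : \bar R := (\sum_(0 <= k <oo) (f k x)%:E)%E.
have s0 x : (0 <= s x)%E by apply: nneseries_ge0 => k _ _; rewrite lee_fin.
have ms : measurable_fun [set: T] s.
  apply: (@ge0_emeasurable_sum _ _ _ _ _ xpredT) => [k x _ _|k _]; last exact: mfE.
  by rewrite lee_fin.
have ints : P.-integrable [set: T] s.
  apply/integrableP; split => //.
  under eq_integral do rewrite gee0_abs//.
  rewrite /s integral_nneseries//; last by move=> k x _; rewrite lee_fin.
  apply: (@le_lt_trans _ _ M%:E); last exact: ltry.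
  apply: lime_le; last by apply: nearW => n; exact: sumM.
  by apply: is_cvg_nneseries => k _ _; apply: integral_ge0 => x _; rewrite lee_fin.
have := integrable_ae measurableT ints; apply: filterS => x /(_ I) sfin.
have soo : (s x < +oo)%E by rewrite ltey_eq sfin.
have tail := nneseries_tail_cvg soo (fun k _ => f0 k x : (0 <= (f k x)%:E)%E).
suff /fine_cvgP[_ h] : (f k x)%:E @[k --> \oo] --> (0 : R)%:E by [].
have le_tail : \forall k \near \oo,
    (0 <= (f k x)%:E <= \sum_(k <= l <oo) (f l x)%:E)%E.
  apply: nearW => k; rewrite lee_fin f0/=.
  have := @nneseries_lim_ge R (fun l => (f l x)%:E) xpredT k k.+1.
  by rewrite big_nat1; apply => l _ _; rewrite lee_fin.
exact: (squeeze_cvge le_tail (cvg_cst 0%E) tail).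
Qed.

(* The squares are spaced so that |s_n| exceeds |s_(k^2)| by at most 2 k C
   for k^2 <= n < (k+1)^2. *)
Lemma cvg_mean_squares (z : nat -> R) (C : R) :
  (forall j, `|z j| <= C) ->
  (k.+1%:R ^- 2 * \sum_(j < k.+1 ^ 2) z j) @[k --> \oo] --> (0 : R) ->
  (n%:R^-1 * \sum_(j < n) z j) @[n --> \oo] --> (0 : R).
Proof.
move=> zC sq.
have C0 : 0 <= C := le_trans (normr_ge0 _) (zC 0%N).
have sumB m n : (m <= n)%N ->
    `|\sum_(j < n) z j| <= `|\sum_(j < m) z j| + (n - m)%:R * C.
  move=> mn; rewrite -(subnKC mn); elim: (n - m)%N => [|l IH].
    by rewrite addn0 subnn mul0r addr0.
  rewrite addnS big_ord_recr/= (le_trans (ler_normD _ _))//.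
  move: IH; rewrite -addnS !addKn => IH.
  by rewrite -natr1 mulrDl mul1r addrA lerD.
have sqrt_ex n : (0 < n)%N ->
    exists k, (k.+1 ^ 2 <= n)%N /\ (n <= k.+1 ^ 2 + k.+1.*2)%N.
  elim: n => // -[_ _|n /(_ isT)[k [kn nk]] _]; first by exists 0%N.
  have [lt|ge] := ltnP n.+1 (k.+1 ^ 2 + k.+1.*2).
    by exists k; rewrite lt (leq_trans kn).
  by exists k.+1; move: kn nk ge; rewrite -!mulnn; nia.
apply/cvgr0Pnorm_le => e e0.
have e20 : 0 < e / 2 by rewrite divr_gt0.
move/cvgr0Pnorm_le : sq => /(_ _ e20)[K _ sqK].
(* [M] is chosen so that for k >= M the gap contribution 2 (k+1) C is at most (k+1)^2 e / 2. *)
have [M M0 CM] : exists2 M : nat, (0 < M)%N & 4 * C <= e * M%:R.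
  exists (Num.truncn (4 * C / e)).+1 => //.
  by rewrite [leRHS]mulrC -ler_pdivrMr// ltW// real_truncnS_gt// num_real.
(* Beyond this rank the square just below [n] has index k >= K + M, so both thresholds are met. *)
exists ((K + M).+1 ^ 2)%N => // n /= KMn.
have n0 : (0 < n)%N by apply: leq_trans KMn; rewrite expn_gt0.
have [k [kn nk]] := sqrt_ex n n0.
have Kk : (K + M <= k)%N.
  rewrite leqNgt; apply/negP => kKM.
  by have : ((K + M) ^ 2 <= n)%N; nia.
have := sqK k (leq_trans (leq_addr _ _) Kk); rewrite /= !normrM.
rewrite ger0_norm ?invr_ge0 ?exprn_ge0// -natrX => sk.
rewrite ger0_norm ?invr_ge0// ler_pdivrMl ?ltr0n//.
apply: le_trans (sumB _ _ kn) _.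
move: sk; rewrite ler_pdivrMl ?ltr0n ?expn_gt0// => sk.
apply: (le_trans (lerD sk (lexx _))).
have nk' : (n - k.+1 ^ 2)%:R * C <= k.+1.*2%:R * C.
  by rewrite ler_wpM2r// ler_nat leq_subLR.
apply: (le_trans (lerD (lexx _) nk')).
have : (k.+1 ^ 2)%:R * (e / 2) <= n%:R * (e / 2) by rewrite ler_pM2r// ler_nat.
have : k.+1.*2%:R * C <= n%:R * (e / 2).
  apply: (@le_trans _ _ ((k.+1 ^ 2)%:R * (e / 2))); last first.
    by rewrite ler_pM2r// ler_nat.
  have kM : M%:R <= k.+1%:R :> R by rewrite ler_nat; lia.
  have k0 : 0 < k.+1%:R :> R by rewrite ltr0n.
  rewrite natrX -muln2 natrM.
  have : e * M%:R <= e * k.+1%:R by rewrite ler_pM2l.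
  nra.
lra.
Qed.

(** The sharper bound 2 - 1/(m+1) is what survives the induction, since 1/(m+2)^2 <= 1/(m+1) -
    1/(m+2). *)
Lemma sum_inv_sqr_le2 n : \sum_(0 <= k < n) k.+1%:R ^- 2 <= 2 :> R.
Proof.
suff h m : \sum_(0 <= k < m.+1) k.+1%:R ^- 2 <= 2 - m.+1%:R^-1 :> R.
  case: n => [|n]; first by rewrite big_nil.
  by rewrite (le_trans (h n))// gerBl invr_ge0.
elim: m => [|m IH]; first by rewrite big_nat1 expr1n invr1; lra.
rewrite big_nat_recr//= (le_trans (lerD IH (lexx _)))//.
rewrite -addrA lerD2l -subr_ge0.
have m0 : 0 < m.+1%:R :> R by rewrite ltr0n.
rewrite -[m.+2%:R]natr1; set a := m.+1%:R in m0 *.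
have -> : - (a + 1)^-1 - (- a^-1 + (a + 1) ^- 2) = a^-1 * (a + 1) ^- 2.
  by field; rewrite !gt_eqF// addr_gt0.
by rewrite mulr_ge0 ?invr_ge0 ?exprn_ge0// ?addr_ge0// ltW.
Qed.

End almost_sure_convergence.

(** * The strong law by second moments *)

Section bounded_slln.
Context {R : realType} d d' (T : measurableType d) (V : measurableType d').
Variables (P : probability T R) (Xs : nat -> {RV P >-> V}).
Hypothesis Xs_indep : mutually_independent Xs.

Lemma independent_pair i j (A B : set V) : i != j ->
  measurable A -> measurable B ->
  P (Xs i @^-1` A `&` Xs j @^-1` B) = (P (Xs i @^-1` A) * P (Xs j @^-1` B))%E.
Proof.
move=> ij mA mB.
have := @Xs_indep [fset i; j]%fset (fun k => if k == i then A else B).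
rewrite big_fsetU1 ?inE//= big_seq_fset1 eqxx eq_sym (negbTE ij) => <-; last first.
  by move=> k _; case: ifP.
congr (P _); apply/seteqP; split => [x [Ai Bj] k /=|x h].
  by rewrite !inE => /orP[]/eqP ->; rewrite ?eqxx// eq_sym (negbTE ij).
split; first by have := h i; rewrite /= !inE !eqxx; exact.
by have := h j; rewrite /= !inE eqxx orbT eq_sym (negbTE ij); exact.
Qed.

(** The law of the pair is the product of the marginal laws, as both agree on rectangles; by Fubini
    the inner integral is a multiple of the mean of [g (Xs j)], which is zero. *)
Lemma independent_uncorrelated i j (g : V -> R) (C : R) : i != j ->
  measurable_fun [set: V] g -> (forall v, `|g v| <= C) ->
  \int[P]_x g (Xs j x) = 0 -> \int[P]_x (g (Xs i x) * g (Xs j x)) = 0.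
Proof.
move=> ij mg gC gj0.
have mXX : measurable_fun [set: T] (fun x => (Xs i x, Xs j x)).
  by apply/measurable_fun_pairP; split; exact: measurable_funPT.
pose XX : {RV P >-> (V * V)%type} := mfun_Sub (mem_set mXX).
pose gg (z : V * V) : \bar R := (g z.1 * g z.2)%:E.
have mgg : measurable_fun [set: V * V] gg.
  apply/measurable_EFinP; apply: measurable_funM.
    exact: (measurableT_comp mg measurable_fst).
  exact: (measurableT_comp mg measurable_snd).
have ggC z : `|g z.1 * g z.2| <= C * C by rewrite normrM ler_pM.
rewrite /Rintegral.
transitivity (fine (\int[distribution P XX]_z gg z)%E).
  rewrite integral_distribution//.
  apply: (@bounded_integrable _ _ _ _ (fun x => g (Xs i x) * g (Xs j x)) (C * C)).
    by apply: measurable_funM; apply: measurableT_comp.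
  by move=> x; rewrite normrM ler_pM.
rewrite -(@eq_measure_integral _ _ _ _ _
  (distribution P (Xs i) \x distribution P (Xs j))%E); last first.
  move=> A mA _; apply: product_measure_unique => // B D mB mD.
  exact: independent_pair.
rewrite -integral12_prod_meas1; last first.
  apply: (@bounded_integrable _ _ _ _ (fun z => g z.1 * g z.2) (C * C)) => //.
  exact/measurable_EFinP.
rewrite (eq_integral (cst 0%E)) ?integral0// => u _.
have gE : P.-integrable [set: T] (EFin \o (g \o Xs j)).
  apply: (@bounded_integrable _ _ _ _ _ C); first exact: measurableT_comp.
  by move=> x /=.
have mgE : measurable_fun [set: V] (EFin \o g) by exact/measurable_EFinP.
transitivity (\int[distribution P (Xs j)]_v ((g u)%:E * (EFin \o g) v))%E => //.
rewrite integralZl//; last exact: (@bounded_integrable _ _ _ _ _ C).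
rewrite integral_distribution//.
have -> : (\int[P]_x ((EFin \o g) \o Xs j) x = 0)%E; last by rewrite mule0.
by rewrite -[LHS]fineK ?integrable_fin_num//; congr EFin.
Qed.

Section centered.
Variables (g : V -> R) (C : R).
Hypotheses (mg : measurable_fun [set: V] g) (gC : forall v, `|g v| <= C).
Hypothesis g0 : forall j, \int[P]_x g (Xs j x) = 0.
Let S n x := \sum_(j < n) g (Xs j x).

Let mgX j : measurable_fun [set: T] (fun x => g (Xs j x)).
Proof. exact: measurableT_comp. Qed.

Let mS n : measurable_fun [set: T] (S n).
Proof. exact: measurable_sum. Qed.

Let S_bound n x : `|S n x| <= n%:R * C.
Proof.
rewrite /S (le_trans (ler_norm_sum _ _ _))//.
apply: (@le_trans _ _ (\sum_(j < n) C)); first by apply: ler_sum => j _.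
by rewrite sumr_const card_ord mulr_natl.
Qed.

Let intM (u v : T -> R) (a b : R) :
  measurable_fun [set: T] u -> measurable_fun [set: T] v ->
  (forall x, `|u x| <= a) -> (forall x, `|v x| <= b) ->
  P.-integrable [set: T] (EFin \o (fun x => u x * v x)).
Proof.
move=> mu mv ua vb; apply: (@bounded_integrable _ _ _ _ _ (a * b)).
  exact: measurable_funM.
by move=> x; rewrite normrM ler_pM.
Qed.

(** Each partial sum is orthogonal to every later term ([cross]), so only the [n] squares remain,
    each of mean at most [C ^+ 2]. *)
Lemma second_moment_sum n :
  \int[P]_x (\sum_(j < n) g (Xs j x)) ^+ 2 <= n%:R * C ^+ 2.
Proof.
have cross m k : (m <= k)%N -> \int[P]_x (S m x * g (Xs k x)) = 0.
  elim: m => [_|m IH mk].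
    rewrite (_ : (fun x => _) = cst 0) ?Rintegral_cst ?mul0r//.
    by apply/funext => x; rewrite /S big_ord0 mul0r.
  rewrite (_ : (fun x => _) =
      (fun x => S m x * g (Xs k x) + g (Xs m x) * g (Xs k x))); last first.
    by apply/funext => x; rewrite /S big_ord_recr/= mulrDl.
  rewrite RintegralD// ?IH ?(ltnW mk)// ?add0r.
  - by apply: (independent_uncorrelated _ mg gC); rewrite ?g0// ltn_eqF.
  - exact: (intM _ _ (S_bound m) (fun x => gC (Xs k x))).
  - exact: (intM _ _ (fun x => gC (Xs m x)) (fun x => gC (Xs k x))).
elim: n => [|n IH].
  rewrite (_ : (fun x => _) = cst 0) ?Rintegral_cst ?mul0r//.
  by apply/funext => x; rewrite big_ord0 expr0n.
rewrite (_ : (fun x => _) = (fun x => S n x ^+ 2 +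
    (2 * (S n x * g (Xs n x)) + g (Xs n x) ^+ 2))); last first.
  by apply/funext => x; rewrite big_ord_recr/= -/(S n x); ring.
have i1 := intM (mS n) (mS n) (S_bound n) (S_bound n).
have i2 := intM (mS n) (mgX n) (S_bound n) (fun x => gC (Xs n x)).
have i3 := intM (mgX n) (mgX n) (fun x => gC (Xs n x)) (fun x => gC (Xs n x)).
have i2' : P.-integrable [set: T] (EFin \o (fun x => 2 * (S n x * g (Xs n x)))).
  exact: (integrableZl measurableT 2%R i2).
rewrite RintegralD//; last exact: (integrableD measurableT i2' i3).
rewrite RintegralD// RintegralZl// cross// mulr0 add0r -natr1 mulrDl mul1r.
apply: lerD; first exact: IH.
apply: (le_trans (ler_norm _)); apply: Rintegral_bound.
  exact: measurable_funM.
by move=> x; rewrite normrX lerXn2r ?nnegrE// (le_trans (normr_ge0 _) (gC (Xs n x))).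
Qed.

(** The mean square of the average over the first (k+1)^2 terms is at most C^2 / (k+1)^2, which is
    summable. This gives convergence along the squares, and boundedness fills the gaps. *)
Lemma slln_centered :
  {ae P, forall x, n%:R^-1 * (\sum_(j < n) g (Xs j x)) @[n --> \oo] --> (0 : R)}.
Proof.
pose f k x := (k.+1%:R ^- 2 * S (k.+1 ^ 2) x) ^+ 2.
have mf k : measurable_fun [set: T] (f k).
  by apply: measurable_funX; apply: measurable_funM.
have f_int k : (\int[P]_x (f k x)%:E <= (C ^+ 2 * k.+1%:R ^- 2)%:E)%E.
  have intS := intM (mS (k.+1 ^ 2)) (mS (k.+1 ^ 2)) (S_bound _) (S_bound _).
  rewrite (eq_integral (fun x =>
    ((k.+1%:R ^- 2) ^+ 2)%:E * (S (k.+1 ^ 2) x ^+ 2)%:E)%E); last first.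
    by move=> x _; rewrite -EFinM /f exprMn.
  rewrite integralZl// -[X in (_ * X)%E]fineK ?integrable_fin_num//.
  rewrite -EFinM lee_fin.
  apply: (@le_trans _ _ ((k.+1%:R ^- 2) ^+ 2 * ((k.+1 ^ 2)%:R * C ^+ 2))).
    by rewrite ler_wpM2l ?sqr_ge0//; exact: second_moment_sum.
  rewrite natrX; set a := k.+1%:R; have a0 : a != 0 :> R by rewrite pnatr_eq0.
  by rewrite le_eqVlt; apply/orP; left; apply/eqP; field.
have := @ae_cvg0_summable _ _ _ P f (C ^+ 2 * 2) mf (fun k x => sqr_ge0 _).
have sumf n : (\sum_(0 <= k < n) \int[P]_x (f k x)%:E <= (C ^+ 2 * 2)%:E)%E.
  apply: (@le_trans _ _ (\sum_(0 <= k < n) (C ^+ 2 * k.+1%:R ^- 2)%:E)%E).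
    by apply: lee_sum => k _; exact: f_int.
  rewrite sumEFin lee_fin -mulr_sumr ler_wpM2l ?sqr_ge0//.
  exact: sum_inv_sqr_le2.
move=> /(_ sumf); apply: filterS => x fx.
apply: (@cvg_mean_squares _ (fun j => g (Xs j x)) C) => //.
apply: norm_cvg0.
have : Num.sqrt (f k x) @[k --> \oo] --> Num.sqrt (0 : R).
  by apply: continuous_cvg fx; exact: sqrt_continuous.
by rewrite sqrtr0; under eq_fun do rewrite sqrtr_sqr.
Qed.

End centered.

Theorem slln_bounded (X : {RV P >-> V}) (f : V -> R) (C : R) :
  (forall j, identically_distributed (Xs j) X) ->
  measurable_fun [set: V] f -> (forall v, `|f v| <= C) ->
  {ae P, forall x, n%:R^-1 * (\sum_(j < n) f (Xs j x)) @[n --> \oo] -->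
    \int[P]_x f (X x)}.
Proof.
move=> XsX mf fC; set m := \int[P]_x f (X x).
have int_f (Y : {RV P >-> V}) : P.-integrable [set: T] (EFin \o (f \o Y)).
  apply: (@bounded_integrable _ _ _ _ _ C); first exact: measurableT_comp.
  by move=> x /=.
have mfE : measurable_fun [set: V] (EFin \o f) by exact/measurable_EFinP.
have fm j : \int[P]_x f (Xs j x) = m.
  rewrite /m /Rintegral; congr fine.
  transitivity (\int[distribution P (Xs j)]_v (f v)%:E)%E.
    by rewrite integral_distribution//; exact: int_f.
  rewrite (@eq_measure_integral _ _ _ _ (distribution P X)) => [|A mA _].
    by rewrite integral_distribution//; exact: int_f.
  exact: XsX.
have int_cst : P.-integrable [set: T] (EFin \o cst m).
  exact: (@bounded_integrable _ _ _ _ _ `|m|).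
have mX j : measurable_fun [set: T] (fun x => f (Xs j x)) by exact: measurableT_comp.
have := @slln_centered (fun v => f v - m) (C + `|m|).
have mfm : measurable_fun [set: V] (fun v => f v - m) by exact: measurable_funB.
have fmC v : `|f v - m| <= C + `|m| by rewrite (le_trans (ler_normB _ _))// lerD2r.
have fm0 j : \int[P]_x (f (Xs j x) - m) = 0.
  rewrite RintegralB//; last exact: (int_f (Xs j)).
  by rewrite fm Rintegral_cst// [X in fine X]probability_setT mulr1 subrr.
move=> /(_ mfm fmC fm0); apply: filterS => x fx; apply/subr_cvg0.
apply: cvg_trans fx; apply: near_eq_cvg; near=> n.
(* At n = 0 the average of the constant [m] is 0 instead of [m], since [0^-1 = 0]. *)
have n0 : n%:R != 0 :> R by rewrite pnatr_eq0 -lt0n; near: n; exists 1%N.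
by rewrite sumrB sumr_const card_ord mulrBr -[m *+ n]mulr_natl mulKf.
Unshelve. all: by end_near.
Qed.

End bounded_slln.

(** * Empirical characteristic functions at converging points *)

Section trigonometric_modulus.
Context {R : realType}.

Lemma derive_bound_lipschitz (f df : R -> R) :
  (forall x, is_derive x (1 : R) f (df x)) -> (forall x, `|df x| <= 1) ->
  forall a b, `|f a - f b| <= `|a - b|.
Proof.
move=> fdf df1; suff h a b : a <= b -> `|f a - f b| <= `|a - b|.
  move=> a b; have [/h//|/ltW/h] := leP a b.
  by rewrite distrC [X in _ <= X]distrC.
move=> ab; rewrite distrC [leRHS]distrC.
have cf : {within `[a, b], continuous f}.
  by apply: derivable_within_continuous => x _; exact: ex_derive.
have [c _ ->] := MVT_segment ab (fun x _ => fdf x) cf.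
by rewrite normrM ler_piMl.
Qed.

Lemma cos_lipschitz (a b : R) : `|cos a - cos b| <= `|a - b|.
Proof.
apply: (@derive_bound_lipschitz _ (fun x => - sin x)) => x.
by rewrite normrN ler_norml sin_geN1 sin_le1.
Qed.

Lemma sin_lipschitz (a b : R) : `|sin a - sin b| <= `|a - b|.
Proof.
apply: (@derive_bound_lipschitz _ cos) => x.
by rewrite ler_norml cos_geN1 cos_le1.
Qed.

Lemma cos_norm_le1 (x : R) : `|cos x| <= 1.
Proof. by rewrite ler_norml cos_geN1 cos_le1. Qed.

Lemma sin_norm_le1 (x : R) : `|sin x| <= 1.
Proof. by rewrite ler_norml sin_geN1 sin_le1. Qed.

End trigonometric_modulus.

Lemma measurable_sqrtr (R : realType) : measurable_fun [set: R] (@Num.sqrt R).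
Proof. by apply: continuous_measurable_fun; exact: sqrt_continuous. Qed.

Section measurable_dotp.
Context {R : realType} {p : nat}.

Lemma measurable_dotp (y : 'cV[R]_p) :
  measurable_fun [set: 'cV[R]_p] (fun t => dotp t y).
Proof.
under eq_fun do rewrite dotpE.
apply: measurable_sum => i; apply: measurable_funM => //.
exact: measurable_mx_entry.
Qed.

Lemma measurable_dotpr (s : 'cV[R]_p) : measurable_fun [set: 'cV[R]_p] (dotp s).
Proof.
rewrite (_ : dotp s = dotp^~ s); first exact: measurable_dotp.
by apply/funext => x; rewrite dotpC.
Qed.

Lemma measurable_phi_stable (a : R) :
  measurable_fun [set: 'cV[R]_p] (phi_stable a).
Proof.
apply: measurableT_comp => //; apply: measurableT_comp => //.
apply: (measurableT_comp (measurable_powR a)).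
rewrite (_ : enorm = Num.sqrt \o (fun t : 'cV[R]_p => dotp t t))//.
apply: measurableT_comp; first exact: measurable_sqrtr.
under eq_fun do rewrite dotpE.
apply: measurable_sum => i; apply: measurable_funM; exact: measurable_mx_entry.
Qed.

Lemma phi_stable_bound (a : R) (t : 'cV[R]_p) : `|phi_stable a t| <= 1.
Proof.
rewrite ger0_norm ?expR_ge0// /phi_stable -expR0 ler_expR oppr_le0.
exact: powR_ge0.
Qed.

End measurable_dotp.

Section modulus.
Context {R : realType} {p : nat}.

(** Bounds the oscillation of [cos (dotp s x)] and [sin (dotp s x)] when the coordinates of [s] move
    by at most 1/(k+1). The cap 2 keeps it bounded, as the strong law and dominated convergence
    require. *)
Definition modulus (k : nat) (x : 'cV[R]_p) : R :=
  Num.min 2 (k.+1%:R^-1 * \sum_i `|x i 0|).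

Lemma modulus_bound k x : `|modulus k x| <= 2.
Proof.
rewrite ger0_norm ?ge_min ?lexx// /modulus le_min ler0n/=.
by rewrite mulr_ge0// sumr_ge0.
Qed.

Lemma measurable_modulus k : measurable_fun [set: 'cV[R]_p] (modulus k).
Proof.
apply: measurable_minr => //; apply: measurable_funM => //.
apply: measurable_sum => i; apply: measurableT_comp => //.
exact: measurable_mx_entry.
Qed.

Lemma modulus_cvg0 x : modulus k x @[k --> \oo] --> (0 : R).
Proof.
have h0 : k.+1%:R^-1 * (\sum_i `|x i 0|) @[k --> \oo] --> (0 : R).
  have := cvgM (@cvg_harmonic R) (cvg_cst (\sum_i `|x i 0|)).
  by rewrite mul0r => h; exact: h.
suff le_h : \forall k \near \oo,
    0 <= modulus k x <= k.+1%:R^-1 * (\sum_i `|x i 0|).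
  exact: (squeeze_cvgr le_h (cvg_cst 0) h0).
apply: nearW => k; rewrite /modulus le_min ge_min lexx orbT ler0n/= andbT.
by rewrite mulr_ge0// sumr_ge0.
Qed.

Lemma le_modulus (f : R -> R) k (s s' x : 'cV[R]_p) :
  (forall a b, `|f a - f b| <= `|a - b|) -> (forall a, `|f a| <= 1) ->
  (forall i, `|s i 0 - s' i 0| <= k.+1%:R^-1) ->
  `|f (dotp s x) - f (dotp s' x)| <= modulus k x.
Proof.
move=> fL f1 ss'; rewrite le_min; apply/andP; split.
  by rewrite (le_trans (ler_normB _ _))// -[leRHS]/(1 + 1) lerD.
apply: (le_trans (fL _ _)); rewrite -dotpBl dotpE.
rewrite (le_trans (ler_norm_sum _ _ _))// mulr_sumr; apply: ler_sum => i _.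
by rewrite normrM ler_wpM2r// !mxE.
Qed.

End modulus.

(** * Trigonometric averages along converging frequencies *)

Section uniform_slln.
Context {R : realType} {p : nat} d (T : measurableType d) (P : probability T R).
Variables (X : {RV P >-> 'cV[R]_p}) (Xs : nat -> {RV P >-> 'cV[R]_p}).
Hypothesis Xs_indep : mutually_independent Xs.
Hypothesis Xs_copies : forall j, identically_distributed (Xs j) X.

Lemma expectation_modulus_cvg0 :
  \int[P]_x modulus k (X x) @[k --> \oo] --> (0 : R).
Proof.
have mm k : measurable_fun [set: T] (EFin \o (modulus k \o X)).
  apply/measurable_EFinP.
  exact: (measurableT_comp (measurable_modulus k) (measurable_funPT X)).
have [] := @dominated_convergence _ _ _ P [set: T] measurableT
  (fun k x => (modulus k (X x))%:E) (cst 0%E) (cst 2%:E) mm.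
- exact: measurable_cst.
- apply: aeW => x _; apply: cvg_EFin; last exact: modulus_cvg0.
  by apply: nearW.
- apply: (@bounded_integrable _ _ _ _ (cst 2) 2); first exact: measurable_cst.
  by move=> x; rewrite ger0_norm.
- by apply: aeW => x k _; rewrite lee_fin modulus_bound.
by move=> _ _; rewrite integral0 => /fine_cvgP[_].
Qed.

(** Indices are coded by natural numbers; a code that decodes to nothing gets the property
    [True]. *)
Lemma ae_forall_countable (I : countType) (Q : I -> T -> Prop) :
  (forall i, {ae P, forall x, Q i x}) -> {ae P, forall x, forall i, Q i x}.
Proof.
move=> aeQ; pose Q' n x := oapp (Q^~ x) True (choice.unpickle n).
have := @ae_foralln _ _ _ P Q'.
have aeQ' n : {ae P, forall x, Q' n x}.
  by rewrite /Q'; case: (choice.unpickle n) => [i|]; [exact: aeQ|exact: aeW].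
move=> /(_ aeQ'); apply: filterS => x Qx i.
by have := Qx (choice.pickle i); rewrite /Q' choice.pickleK.
Qed.

(* Almost surely the averages converge at all rational points, and the averages
   of the moduli converge; a rational point close to s then gives all s at
   once, with s_ n allowed to depend on the outcome. *)
Lemma slln_uniform (f : R -> R) : continuous f ->
  (forall a b, `|f a - f b| <= `|a - b|) -> (forall a, `|f a| <= 1) ->
  {ae P, forall x, forall (s_ : nat -> 'cV[R]_p) (s : 'cV[R]_p),
    (forall i, s_ n i 0 @[n --> \oo] --> s i 0) ->
    n%:R^-1 * (\sum_(j < n) f (dotp (s_ n) (Xs j x))) @[n --> \oo] -->
    \int[P]_y f (dotp s (X y))}.
Proof.
move=> cf fL f1.
have mf s : measurable_fun [set: 'cV[R]_p] (fun v => f (dotp s v)).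
  exact: (measurableT_comp (continuous_measurable_fun cf) (measurable_dotpr s)).
have aeq := ae_forall_countable (fun q : 'cV[rat]_p => slln_bounded Xs_indep
  Xs_copies (mf (map_mx ratr q)) (fun v => f1 (dotp (map_mx ratr q) v))).
have aem := ae_foralln (fun k => slln_bounded Xs_indep Xs_copies
  (@measurable_modulus R p k) (modulus_bound k)).
apply: filterS2 aeq aem => x avgq avgm s_ s s_s.
(* Error budget: e/4 from [s] to the rational point in the mean, e/2 from [s_ n] to it in the
   average (mean modulus plus its sampling error), and e/4 for the sampling error at the rational
   point. *)
apply/cvgrPdist_le => e e0; have e4 : 0 < e / 4 by rewrite divr_gt0.
have /cvgr0Pnorm_le/(_ _ e4)[k _ /(_ k (leqnn k)) gk] := expectation_modulus_cvg0.
set h : R := k.+1%:R^-1; have h0 : 0 < h by rewrite invr_gt0.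
have h2 : 0 < h / 2 by rewrite divr_gt0.
(* The rational point is within h/2 of [s], and eventually so is [s_ n]; their distance is then at
   most h, as [le_modulus] demands. *)
have /choice[q0 q0P] : forall i, exists q : rat, `|s i 0 - ratr q| <= h / 2.
  move=> i; have /rat_in_itvoo[q] : s i 0 - h / 2 < s i 0 by rewrite gtrBl.
  rewrite in_itv/= => /andP[q1 q2]; exists q.
  by rewrite ger0_norm ?subr_ge0 ?(ltW q2)// lerBlDr -lerBlDl ltW.
pose q : 'cV[rat]_p := \col_i q0 i; pose qR : 'cV[R]_p := map_mx ratr q.
have sq i : `|s i 0 - qR i 0| <= h / 2 by rewrite !mxE.
have int_ft t : P.-integrable [set: T] (EFin \o (fun y => f (dotp t (X y)))).
  apply: (@bounded_integrable _ _ _ _ _ 1).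
    exact: (measurableT_comp (mf t) (measurable_funPT X)).
  by move=> y /=.
have phi_sq : `|\int[P]_y f (dotp s (X y)) - \int[P]_y f (dotp qR (X y))| <= e / 4.
  rewrite -RintegralB//.
  have intB := integrableB measurableT (int_ft s) (int_ft qR).
  apply: (le_trans (le_normr_Rintegral measurableT intB)).
  apply: le_trans (le_trans (ler_norm _) gk).
  have int_m : P.-integrable [set: T] (EFin \o (modulus k \o X)).
    apply: (@bounded_integrable _ _ _ _ _ 2).
      exact: (measurableT_comp (measurable_modulus k) (measurable_funPT X)).
    by move=> y /=; exact: modulus_bound.
  apply: le_Rintegral => //; first exact: integrable_norm.
  move=> y _; apply: le_modulus => // i.
  by rewrite (le_trans (sq i))// -/h; lra.
have near_s : \forall n \near \oo, forall i, `|s i 0 - s_ n i 0| <= h / 2.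
  by apply: filter_forall => i; have /cvgrPdist_le/(_ _ h2) := s_s i.
near=> n.
have snq i : `|s_ n i 0 - qR i 0| <= h.
  rewrite -(subrK (s i 0) (s_ n i 0)) -addrA (le_trans (ler_normD _ _))//.
  rewrite [leRHS]splitr lerD ?sq// distrC.
  by move: i; near: n.
have avg_sq : `|n%:R^-1 * (\sum_(j < n) f (dotp (s_ n) (Xs j x))) -
    n%:R^-1 * (\sum_(j < n) f (dotp qR (Xs j x)))| <=
    n%:R^-1 * (\sum_(j < n) modulus k (Xs j x)).
  rewrite -mulrBr -sumrB normrM ger0_norm ?invr_ge0// ler_wpM2l ?invr_ge0//.
  rewrite (le_trans (ler_norm_sum _ _ _))//; apply: ler_sum => j _.
  exact: le_modulus.
have avg_m : `|\int[P]_y modulus k (X y) -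
    n%:R^-1 * (\sum_(j < n) modulus k (Xs j x))| <= e / 4.
  by near: n; have /cvgrPdist_le/(_ _ e4) := avgm k.
have avg_q : `|\int[P]_y f (dotp qR (X y)) -
    n%:R^-1 * (\sum_(j < n) f (dotp qR (Xs j x)))| <= e / 4.
  by near: n; have /cvgrPdist_le/(_ _ e4) := avgq q.
move: gk phi_sq avg_sq avg_m avg_q; rewrite !ler_norml; lra.
Unshelve. all: by end_near.
Qed.

End uniform_slln.

(** * The test statistic *)

Section rotated_ecf.
Context {R : realType} {p : nat}.
Implicit Types (Q : 'M[R]_p) (delta t : 'cV[R]_p).

Lemma normc_sqr (z : R[i]) :
  Normc.normc z ^+ 2 = complex.Re z ^+ 2 + complex.Im z ^+ 2.
Proof. by case: z => a b /=; rewrite sqr_sqrtr// addr_ge0// sqr_ge0. Qed.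

Lemma expiD (a b : R) : expi (a + b) = expi a * expi b.
Proof.
rewrite /expi cosD sinD; apply/eqP; rewrite eq_complex/=.
by apply/andP; split; apply/eqP; ring.
Qed.

Lemma normc_expi (a : R) : Normc.normc (expi a) = 1.
Proof. by rewrite /= cos2Dsin2 sqrtr1. Qed.

(* Multiplying by the unimodular expi (t . Q^(-1/2) delta) undoes the centering
   of the data. *)
Lemma ecf_standardize alpha delta Q n (x : n.-tuple 'cV[R]_p) t :
  let s := (invsqrtmx Q)^T *m t in
  Normc.normc (ecf (standardize delta Q x) t - (phi_stable alpha t)%:C%C) ^+ 2 =
  (n%:R^-1 * (\sum_(j < n) cos (dotp s (tnth x j)))
     - cos (dotp s delta) * phi_stable alpha t) ^+ 2 +
  (n%:R^-1 * (\sum_(j < n) sin (dotp s (tnth x j)))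
     - sin (dotp s delta) * phi_stable alpha t) ^+ 2.
Proof.
move=> s; set u := _ - _; pose z := u * expi (dotp s delta).
have -> : Normc.normc u = Normc.normc z by rewrite Normc.normcM normc_expi mulr1.
rewrite normc_sqr.
have zE : z = n%:R^-1 * (\sum_(j < n) expi (dotp s (tnth x j))) -
    (phi_stable alpha t)%:C%C * expi (dotp s delta).
  rewrite /z /u mulrBl /ecf -mulrA mulr_suml; congr (_ * _ - _).
  apply: eq_bigr => j _; rewrite -expiD tnth_mktuple dotp_mulmx -/s dotpBr.
  by rewrite subrK.
have nE : n%:R^-1 = (n%:R^-1 : R)%:C%C by rewrite fmorphV rmorph_nat.
have sumE : \sum_(j < n) expi (dotp s (tnth x j)) =
   ((\sum_(j < n) cos (dotp s (tnth x j))) +i*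
    (\sum_(j < n) sin (dotp s (tnth x j))))%C.
  by apply/eqP; rewrite eq_complex !raddf_sum/= !eqxx.
rewrite zE nE sumE /=; congr (_ ^+ 2 + _ ^+ 2); ring.
Qed.

End rotated_ecf.

(** * Limits under the weighted integral *)

Section statistic_limit.
Context {R : realType} {p : nat} (w : 'cV[R]_p -> R).
Hypotheses (w_meas : measurable_fun [set: 'cV[R]_p] w) (w_ge0 : forall t, 0 <= w t).
Hypothesis w_int : (\int[lebesgue_col p]_t (w t)%:E < +oo)%E.

(** Dominated convergence with bound [C * w]; the limit integrand is measurable as a pointwise
    limit. *)
Lemma weighted_Rintegral_cvg (h : nat -> 'cV[R]_p -> R) (l : 'cV[R]_p -> R) (C : R) :
  (forall n, measurable_fun [set: 'cV[R]_p] (h n)) ->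
  (forall n t, `|h n t| <= C) ->
  (forall t, h n t @[n --> \oo] --> l t) ->
  \int[lebesgue_col p]_t (h n t * w t) @[n --> \oo] -->
  \int[lebesgue_col p]_t (l t * w t).
Proof.
move=> mh hC hl; have mhw n : measurable_fun [set: 'cV[R]_p] (fun t => h n t * w t).
  exact: measurable_funM.
have hlw t : h n t * w t @[n --> \oo] --> l t * w t.
  by apply: cvgM => //; exact: cvg_cst.
have mlw : measurable_fun [set: 'cV[R]_p] (fun t => l t * w t).
  by apply: (measurable_fun_cvg mhw) => t _; exact: hlw.
have int_w : (lebesgue_col p).-integrable [set: 'cV[R]_p] (EFin \o w).
  apply/integrableP; split; first exact/measurable_EFinP.
  rewrite (eq_integral (fun t => (w t)%:E))// => t _.
  by rewrite /= ger0_norm.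
have int_Cw :
    (lebesgue_col p).-integrable [set: 'cV[R]_p] (fun t => C%:E * (w t)%:E)%E.
  exact: integrableZl.
have [|||||ilw _] := @dominated_convergence _ _ _ (lebesgue_col p) [set: 'cV[R]_p]
  measurableT (fun n t => (h n t * w t)%:E) (fun t => (l t * w t)%:E)
  (fun t => C%:E * (w t)%:E)%E.
- by move=> n; exact/measurable_EFinP.
- exact/measurable_EFinP.
- apply: aeW => t _; apply: cvg_EFin; last exact: hlw.
  by apply: nearW.
- exact: int_Cw.
- apply: aeW => t n _; rewrite -EFinM lee_fin normrM (ger0_norm (w_ge0 t)).
  by rewrite ler_wpM2r.
have fin_l := integrable_fin_num measurableT ilw.
by rewrite -[X in _ --> X]fineK// => /fine_cvgP[_].
Qed.

End statistic_limit.

Lemma mean_norm_le1 (R : realType) n (z : 'I_n -> R) :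
  (forall j, `|z j| <= 1) -> `|n%:R^-1 * (\sum_j z j)| <= 1.
Proof.
move=> z1; have : `|\sum_j z j| <= n%:R.
  rewrite (le_trans (ler_norm_sum _ _ _))//.
  apply: (@le_trans _ _ (\sum_(j < n) 1)); first exact: ler_sum.
  by rewrite sumr_const card_ord.
(* For n = 0 the prefactor is [0^-1 = 0], so the mean vanishes. *)
case: n z z1 => [|n] z z1 zn; first by rewrite invr0 mul0r normr0 ler01.
by rewrite normrM ger0_norm ?invr_ge0// ler_pdivrMl ?ltr0n// mulr1.
Qed.

Lemma sqr_subM_le4 (R : realType) (a b c : R) :
  `|a| <= 1 -> `|b| <= 1 -> `|c| <= 1 -> `|(a - b * c) ^+ 2| <= 4.
Proof.
move=> a1 b1 c1; rewrite normrX (_ : 4 = 2 ^+ 2); last by ring.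
rewrite lerXn2r ?nnegrE// (le_trans (ler_normB _ _))//.
by rewrite -[leRHS]/(1 + 1) lerD// normrM mulr_ile1.
Qed.

Theorem proposition4p1 (R : realType) (p : nat) (p_ge1 : (1 <= p)%N)
  (alpha0 : R) (alpha0_gt0 : 0 < alpha0) (alpha0_le2 : alpha0 <= 2)
  (w : 'cV[R]_p -> R) (w_meas : measurable_fun [set: 'cV[R]_p] w)
  (w_ge0 : forall t, 0 <= w t)
  (w_gt0 : {ae lebesgue_col p, forall t, 0 < w t})
  (w_sym : forall t, w t = w (- t))
  (w_int : (\int[lebesgue_col p]_t (w t)%:E < +oo)%E)
  (d : measure_display) (T : measurableType d) (P : probability T R)
  (X : {RV P >-> 'cV[R]_p}) (Xs : nat -> {RV P >-> 'cV[R]_p})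
  (Xs_indep : mutually_independent Xs)
  (Xs_copies : forall j, identically_distributed (Xs j) X)
  (delta_hat : forall n, n.-tuple 'cV[R]_p -> 'cV[R]_p)
  (Q_hat : forall n, n.-tuple 'cV[R]_p -> 'M[R]_p)
  (delta_hat_meas : forall n, (1 <= n)%N ->
    measurable_fun [set: n.-tuple 'cV[R]_p] (delta_hat n))
  (Q_hat_meas : forall n, (1 <= n)%N ->
    measurable_fun [set: n.-tuple 'cV[R]_p] (Q_hat n))
  (Q_hat_posdef : forall n (x : n.-tuple 'cV[R]_p), (1 <= n)%N ->
    posdefmx (Q_hat n x))
  (delta_X : 'cV[R]_p) (Q_X : 'M[R]_p) (Q_X_posdef : posdefmx Q_X)
  (estimators_cvg : {ae P, forall x,
    (delta_hat n (sample Xs n x), Q_hat n (sample Xs n x)) @[n --> \oo]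
      --> (delta_X, Q_X)}) :
  {ae P, forall x,
    test_statistic alpha0 w (delta_hat n (sample Xs n x))
      (Q_hat n (sample Xs n x)) (sample Xs n x) / n%:R @[n --> \oo] -->
    \int[lebesgue_col p]_t
      (Normc.normc (charfun X (invsqrtmx Q_X *m t)
                    - expi (dotp t (invsqrtmx Q_X *m delta_X))
                      * (phi_stable alpha0 t)%:C%C) ^+ 2 * w t)}.
Proof.
have aec := slln_uniform Xs_indep Xs_copies (@continuous_cos R)
  (@cos_lipschitz R) (@cos_norm_le1 R).
have aes := slln_uniform Xs_indep Xs_copies (@continuous_sin R)
  (@sin_lipschitz R) (@sin_norm_le1 R).
apply: filterS3 estimators_cvg aec aes => x est avg_cos avg_sin.
pose D n := delta_hat n (sample Xs n x); pose Q n := Q_hat n (sample Xs n x).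
(* The outcome [x] is now fixed and the rest is deterministic. The transpose matches
   [ecf_standardize]; in the limit it disappears by symmetry of [A]. *)
pose s n (t : 'cV[R]_p) := (invsqrtmx (Q n))^T *m t; pose A := invsqrtmx Q_X.
have AT : A^T = A by exact: trmx_invsqrtmx.
have estD : D n @[n --> \oo] --> delta_X.
  have fst_cvg : fst z @[z --> (delta_X, Q_X)] --> delta_X by exact: cvg_fst.
  exact: (cvg_comp _ _ est fst_cvg).
have estQ : Q n @[n --> \oo] --> Q_X.
  have snd_cvg : snd z @[z --> (delta_X, Q_X)] --> Q_X by exact: cvg_snd.
  exact: (cvg_comp _ _ est snd_cvg).
have D_cvg i : D n i 0 @[n --> \oo] --> delta_X i 0.
  exact: (cvg_comp _ _ estD (@coord_continuous R p 1 i 0 delta_X)).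
have Q_cvg i j : Q n i j @[n --> \oo] --> Q_X i j.
  exact: (cvg_comp _ _ estQ (@coord_continuous R p p i j Q_X)).
have A_cvg i j : invsqrtmx (Q n) i j @[n --> \oo] --> A i j.
  by apply: invsqrtmx_cvg => // n n0; exact: Q_hat_posdef.
have s_cvg t i : s n t i 0 @[n --> \oo] --> (A *m t) i 0.
  rewrite -[in X in _ --> X]AT mxE; under eq_fun do rewrite mxE.
  apply: cvg_big => [|k _]; first exact: add_continuous.
  apply: cvgM; last exact: cvg_cst.
  by rewrite mxE; under eq_fun do rewrite mxE; exact: A_cvg.
have theta_cvg t : dotp (s n t) (D n) @[n --> \oo] --> dotp t (A *m delta_X).
  rewrite dotp_mulmx AT dotpE; under eq_fun do rewrite dotpE.
  apply: cvg_big => [|k _]; first exact: add_continuous.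
  by apply: cvgM; [exact: s_cvg|exact: D_cvg].
(* [f] is [cos] or [sin]: the real and imaginary parts of the integrand after rotation. *)
pose term (f : R -> R) n t := n%:R^-1 * (\sum_(j < n) f (dotp (s n t) (Xs j x)))
  - f (dotp (s n t) (D n)) * phi_stable alpha0 t.
pose h n t := term cos n t ^+ 2 + term sin n t ^+ 2.
pose lim_term (f : R -> R) t := \int[P]_y f (dotp (A *m t) (X y))
  - f (dotp t (A *m delta_X)) * phi_stable alpha0 t.
pose l t := lim_term cos t ^+ 2 + lim_term sin t ^+ 2.
have mterm (f : R -> R) n : continuous f ->
    measurable_fun [set: 'cV[R]_p] (term f n).
  move=> cf.
  have mf y : measurable_fun [set: 'cV[R]_p] (fun t => f (dotp (s n t) y)).
    under eq_fun do rewrite -dotp_mulmx.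
    exact: (measurableT_comp (continuous_measurable_fun cf) (measurable_dotp _)).
  apply: measurable_funB; apply: measurable_funM => //.
    by apply: measurable_sum => j; exact: mf.
  exact: measurable_phi_stable.
have mh n : measurable_fun [set: 'cV[R]_p] (h n).
  by apply: measurable_funD; apply: measurable_funX; apply: mterm;
    [exact: continuous_cos|exact: continuous_sin].
have hC n t : `|h n t| <= 8.
  rewrite (le_trans (ler_normD _ _))// (_ : 8 = 4 + 4); last by ring.
  by rewrite lerD// sqr_subM_le4 ?phi_stable_bound ?mean_norm_le1 ?cos_norm_le1
    ?sin_norm_le1// => j; rewrite ?cos_norm_le1 ?sin_norm_le1.
have sqr_cvg (u : nat -> R) (a : R) : u n @[n --> \oo] --> a ->
    u n ^+ 2 @[n --> \oo] --> a ^+ 2.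
  by move=> ua; have := cvgM ua ua => h'; exact: h'.
have hl t : h n t @[n --> \oo] --> l t.
  (* The frequencies [s n t] depend on the outcome through the estimators, so the strong law is
     needed in its form for arbitrary converging sequences. *)
  apply: cvgD; apply: sqr_cvg; apply: cvgB.
  - exact: (avg_cos (s^~ t)).
  - apply: cvgM; last exact: cvg_cst.
    by apply: continuous_cvg (theta_cvg t); exact: continuous_cos.
  - exact: (avg_sin (s^~ t)).
  - apply: cvgM; last exact: cvg_cst.
    by apply: continuous_cvg (theta_cvg t); exact: continuous_sin.
rewrite (@eq_Rintegral _ _ _ _ _ (fun t => l t * w t)); last first.
  move=> t _; rewrite normc_sqr /l /lim_term /charfun unlock -/A.
  by congr ((_ ^+ 2 + _ ^+ 2) * _) => /=; rewrite ?mulr0 ?subr0 ?add0r ?addr0.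
apply: cvg_trans (weighted_Rintegral_cvg w_meas w_ge0 w_int mh hC hl).
apply: near_eq_cvg; near=> n.
(* The factor [n] in the statistic cancels against the division only for n > 0. *)
have n0 : n%:R != 0 :> R by rewrite pnatr_eq0 -lt0n; near: n; exists 1%N.
rewrite /test_statistic mulrAC divff// mul1r; apply: eq_Rintegral => t _.
rewrite ecf_standardize /h /term -/(s n t).
by congr (((_ * _ - _) ^+ 2 + (_ * _ - _) ^+ 2) * _); apply: eq_bigr => j _;
  rewrite tnth_mktuple.
Unshelve. all: by end_near.
Qed.
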